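(* Let $n\ge3$, let $\mathcal G$ be the 1-to-many graph on $\{1,\dots,n\}$ (edges $nj$, $j=1,\dots,n-1$), and let $(\mathcal G,\mathbf g)$ be a target bearing formation, $\mathbf g=(\mathbf g_{nj})_{j=1}^{n-1}$ with $\mathbf g_{nj}\in\mathbb S^{d-1}$, satisfying Assumption 1. Assume that $p_i(0)=\mathrm p_i$, $i=1,\dots,n-1$, for a configuration $\mathrm p=(\mathrm p_1,\dots,\mathrm p_n)\in F_B^{-1}(\mathbf g)$. Then $$\mathrm p_n=\Big(\sum_{j=1}^{n-1}P_{\mathbf g_{nj}}\Big)^{-1}\Big(\sum_{j=1}^{n-1}P_{\mathbf g_{nj}}\mathrm p_j\Big)$$ is an equilibrium (for the follower position $p_n$) of the dynamics $$\dot p_i(t)=0,\ i=1,\dots,n-1,\qquad \dot p_n(t)=-\sum_{j=1}^{n-1}P_{g_{nj}(t)}\mathbf g_{nj}.$$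
   Context: Agents have positions $p_i(t)\in\mathbb R^d$ (typically $d\in\{2,3\}$). The bearing is $g_{ij}=\frac{p_j-p_i}{\|p_j-p_i\|}\in\mathbb S^{d-1}$. For $x\ne0$, $P_x=I_d-\frac{xx^T}{\|x\|^2}$. The 1-to-many directed graph has leaders $1,\dots,n-1$ with no outgoing edges and one follower $n$ with edges $nj$ to every leader $j$. The bearing function $F_B$ maps a configuration $p=(p_1,\dots,p_n)$ to the stacked vector of bearings $g_{nj}$, $j=1,\dots,n-1$. Assumption 1: $(\mathcal G,\mathbf g)$ is realizable (i.e. $F_B^{-1}(\mathbf g)\ne\emptyset$), and there exists $\mathrm p\in F_B^{-1}(\mathbf g)$ such that $\mathrm p_i,\mathrm p_j,\mathrm p_n$ are not collinear for any distinct $i,j\in\{1,\dots,n-1\}$. *)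

(* Defs.v *)
From HB Require Import structures.
From mathcomp Require Import all_boot all_order all_algebra.
From mathcomp Require Import all_classical all_reals all_analysis.
Import Order.TTheory GRing.Theory Num.Theory.
Import numFieldNormedType.Exports.

Set Implicit Arguments.
Unset Strict Implicit.
Unset Printing Implicit Defensive.

Local Open Scope classical_set_scope.
Local Open Scope ring_scope.

(* The library norm on matrices is the sup norm; bearings need the Euclidean
   one. *)
Definition enorm (R : realType) (d : nat) (x : 'cV[R]_d) : R :=
  Num.sqrt (\sum_(i < d) x i 0 ^+ 2).

(* Meaningful for p <> q; the value at p = q is the junk value 0. *)
Definition bearing (R : realType) (d : nat) (p q : 'cV[R]_d) : 'cV[R]_d :=
  (enorm (q - p))^-1 *: (q - p).

(* Meaningful for x <> 0. *)
Definition oproj (R : realType) (d : nat) (x : 'cV[R]_d) : 'M[R]_d :=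
  1%:M - (enorm x ^+ 2)^-1 *: (x *m x^T).

Definition collinear (R : realType) (d : nat) (x y z : 'cV[R]_d) : Prop :=
  exists a v : 'cV[R]_d, forall w : 'cV[R]_d,
    [\/ w = x, w = y | w = z] -> exists c : R, w = a + c *: v.

(* The 1-to-many graph has n = m.+1 vertices: the leaders 0, ..., m - 1 and the
   follower m, with edge set {(follower, leader j) | j < m}. *)
Definition follower (m : nat) : 'I_m.+1 := ord_max.

(* As a natural number, leader j is j. *)
Definition leader (m : nat) (j : 'I_m) : 'I_m.+1 := lift ord_max j.

Definition configuration (R : realType) (d m : nat) : Type :=
  'I_m.+1 -> 'cV[R]_d.

(* The domain of the bearing function, i.e. the configurations for which the
   bearing of every edge of the 1-to-many graph is defined. *)
Definition bearings_defined (R : realType) (d m : nat) :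
    set (configuration R d m) :=
  [set p | forall j : 'I_m, p (leader j) != p (follower m)].

Definition bearing_function (R : realType) (d m : nat)
    (p : configuration R d m) : 'I_m -> 'cV[R]_d :=
  fun j => bearing (p (follower m)) (p (leader j)).

Definition bearing_fiber (R : realType) (d m : nat) (g : 'I_m -> 'cV[R]_d) :
    set (configuration R d m) :=
  @bearings_defined R d m `&` @bearing_function R d m @^-1` [set g].

Definition realizable (R : realType) (d m : nat) (g : 'I_m -> 'cV[R]_d) :
    Prop :=
  bearing_fiber g !=set0.

Definition assumption1 (R : realType) (d m : nat) (g : 'I_m -> 'cV[R]_d) :
    Prop :=
  realizable g /\
  exists2 p, bearing_fiber g p &
    forall i j : 'I_m, i != j ->
      ~ collinear (p (leader i)) (p (leader j)) (p (follower m)).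

(* Solutions on [0, +oo[ of x'(t) = f t (x t): continuous up to the initial time
   and satisfying the equation at positive times. *)
Definition is_solution (R : realType) (d : nat)
    (f : R -> 'cV[R]_d -> 'cV[R]_d) (x : R -> 'cV[R]_d) : Prop :=
  {within `[0, +oo[, continuous x} /\
  forall t : R, 0 < t -> is_derive t 1 x (f t (x t)).

(* Equilibria of x'(t) = f t (x t) on [0, +oo[, where f t is defined on D t. *)
Definition is_equilibrium (R : realType) (d : nat) (D : R -> set 'cV[R]_d)
    (f : R -> 'cV[R]_d -> 'cV[R]_d) (x : 'cV[R]_d) : Prop :=
  forall t : R, 0 <= t -> D t x /\ f t x = 0.

Definition with_follower (R : realType) (d m : nat) (l : 'I_m -> 'cV[R]_d)
    (x : 'cV[R]_d) : configuration R d m :=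
  fun k => if unlift (follower m) k is Some j then l j else x.

Definition follower_velocity (R : realType) (d m : nat)
    (g : 'I_m -> 'cV[R]_d) (p : configuration R d m) : 'cV[R]_d :=
  - \sum_(j < m) oproj (bearing_function p j) *m g j.

(* The follower's equation is x'(t) = follower_velocity g (with_follower (l t)
   x(t)), a time-dependent one once the leader trajectories l are given. *)
Definition follower_equilibrium (R : realType) (d m : nat)
    (g : 'I_m -> 'cV[R]_d) (l : R -> 'I_m -> 'cV[R]_d) (x : 'cV[R]_d) : Prop :=
  is_equilibrium (fun t => [set y | bearings_defined (with_follower (l t) y)])
    (fun t y => follower_velocity g (with_follower (l t) y)) x.

(* Main.v *)
(* Each P_g is an orthogonal projection with kernel the line spanned by g, so a
   vector killed by the sum of the P_{g_nj} is killed by each of them and hence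
   parallel to every g_nj; two non-parallel bearings thus make the sum
   invertible.  Since p_j - p_n is a multiple of g_nj, P_{g_nj} p_j =
   P_{g_nj} p_n, and summing gives the formula for p_n.  The leaders stay at
   their initial positions, so at p_n the bearings are the targets at all times
   and every term P_{g_nj} g_nj of the velocity vanishes. *)
Require Import Defs.
From mathcomp Require Import all_boot all_order all_algebra.
From mathcomp Require Import all_classical all_reals all_analysis.
Import Order.TTheory GRing.Theory Num.Theory.
Import numFieldNormedType.Exports.
Local Open Scope classical_set_scope.
Local Open Scope ring_scope.

(** Stated for rows because it is applied both to transposed columns, for the Euclidean norm, and to
    the rows [v *m oproj (g j)] of the kernel argument. *)
Lemma mulmx_trmx_self (R : comNzRingType) (d : nat) (v : 'rV[R]_d) :
  v *m v^T = (\sum_i v 0 i ^+ 2)%:M.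
Proof.
rewrite [LHS]mx11_scalar mxE; congr (_%:M).
by apply: eq_bigr => i _; rewrite mxE expr2.
Qed.

Lemma trmx_mul_enorm (R : realType) (d : nat) (x : 'cV[R]_d) :
  x^T *m x = (enorm x ^+ 2)%:M.
Proof.
rewrite -{2}[x]trmxK mulmx_trmx_self /enorm sqr_sqrtr ?sumr_ge0// => [|i _].
  by congr (_%:M); apply: eq_bigr => i _; rewrite mxE.
exact: sqr_ge0.
Qed.

Lemma enorm_neq0 (R : realType) (d : nat) (x : 'cV[R]_d) :
  x != 0 -> enorm x != 0.
Proof.
apply: contra_neq => x0; have := trmx_mul_enorm _ _ x.
rewrite -{2}[x]trmxK mulmx_trmx_self x0 expr0n => /matrixP /(_ 0 0).
rewrite !mxE mulr1n => /eqP; rewrite psumr_eq0 => [/allP xi0|i _]; last first.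
  exact: sqr_ge0.
apply/matrixP => i j; rewrite (ord1 j) mxE; apply/eqP.
by have := xi0 i (mem_index_enum i); rewrite mxE sqrf_eq0.
Qed.

Lemma bearing_scale (R : realType) (d : nat) (x y : 'cV[R]_d) :
  y != x -> y - x = enorm (y - x) *: bearing x y.
Proof.
rewrite -subr_eq0 => /enorm_neq0 yx0.
by rewrite /bearing scalerA divff ?scale1r.
Qed.

Lemma oprojE (R : realType) (d : nat) (g : 'cV[R]_d) :
  enorm g = 1 -> oproj g = 1%:M - g *m g^T.
Proof. by move=> g1; rewrite /oproj g1 expr1n invr1 scale1r. Qed.

Lemma oproj_self (R : realType) (d : nat) (g : 'cV[R]_d) :
  enorm g = 1 -> oproj g *m g = 0.
Proof.
move=> g1; rewrite oprojE// mulmxBl mul1mx -mulmxA trmx_mul_enorm g1 expr1n.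
by rewrite mulmx1 subrr.
Qed.

Lemma tr_oproj (R : realType) (d : nat) (g : 'cV[R]_d) :
  (oproj g)^T = oproj g.
Proof. by rewrite /oproj linearB linearZ /= trmx1 trmx_mul trmxK. Qed.

Lemma oproj_idem (R : realType) (d : nat) (g : 'cV[R]_d) :
  enorm g = 1 -> oproj g *m oproj g = oproj g.
Proof.
move=> g1; rewrite {2}oprojE// mulmxBr mulmx1 mulmxA oproj_self// mul0mx.
by rewrite subr0.
Qed.

(** Multiplying by [v^T] on the right turns the hypothesis into the vanishing of a sum of squared
    Euclidean norms, so each of them is zero. *)
Lemma sum_oproj_ker (R : realType) (d m : nat) (g : 'I_m -> 'cV[R]_d)
    (v : 'rV[R]_d) :
  (forall j, enorm (g j) = 1) -> v *m (\sum_j oproj (g j)) = 0 ->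
  forall j, v *m oproj (g j) = 0.
Proof.
move=> g1 /(congr1 (mulmx^~ v^T)); rewrite mul0mx mulmx_sumr mulmx_suml.
(* As $P$ is symmetric and idempotent, $vPv^T = (vP)(vP)^T = \|vP\|^2$. *)
have q j : v *m oproj (g j) *m v^T =
    (\sum_i (v *m oproj (g j)) 0 i ^+ 2)%:M.
  rewrite -mulmx_trmx_self trmx_mul tr_oproj mulmxA -[in RHS](mulmxA v).
  by rewrite oproj_idem.
under eq_bigr do rewrite q.
have q0 j : 0 <= \sum_i (v *m oproj (g j)) 0 i ^+ 2.
  by apply: sumr_ge0 => i _; exact: sqr_ge0.
move=> /matrixP /(_ 0 0); rewrite summxE mxE.
under eq_bigr do rewrite mxE mulr1n.
move=> /eqP; rewrite psumr_eq0 => [/allP s0 j|j _]; last exact: q0.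
have := s0 j (mem_index_enum j); rewrite psumr_eq0 => [/allP vi0|i _].
  apply/matrixP => k i; rewrite (ord1 k) [RHS]mxE; apply/eqP.
  by rewrite -sqrf_eq0; exact: vi0 (mem_index_enum i).
exact: sqr_ge0.
Qed.

(** The equation $vP_g = 0$ reads $v = (vg)\,g^T$; the scalar $vg$ is nonzero because $v$ is, so it
    can be inverted. *)
Lemma oproj_ker (R : realType) (d : nat) (g : 'cV[R]_d) (v : 'rV[R]_d) :
  enorm g = 1 -> v *m oproj g = 0 -> v != 0 -> exists c, g = c *: v^T.
Proof.
move=> g1; rewrite oprojE// mulmxBr mulmx1 mulmxA => /subr0_eq.
rewrite [v *m g]mx11_scalar mul_scalar_mx; set c := (_ 0 0) => vE v0.
have c0 : c != 0 by apply: contra_neq v0; rewrite vE => ->; rewrite scale0r.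
by exists c^-1; rewrite vE linearZ /= trmxK scalerA mulVf ?scale1r.
Qed.

(** A nonzero row [v] in the kernel would put every leader of the configuration from [assumption1]
    on the line through the follower with direction [v^T]. *)
Lemma sum_oproj_unitmx (R : realType) (d m : nat) (g : 'I_m -> 'cV[R]_d) :
  (1 < m)%N -> (forall j, enorm (g j) = 1) -> assumption1 g ->
  \sum_j oproj (g j) \in unitmx.
Proof.
move=> m1 g1 [_ [p [pD pg] ncol]].
rewrite -row_free_unit; apply: inj_row_free => v.
move=> /(sum_oproj_ker _ _ _ _ _ g1) vP.
apply/eqP/negPn/negP => v0.
have par j : exists c, p (leader j) = p (follower m) + c *: v^T.
  have [c gE] := oproj_ker _ _ _ _ (g1 j) (vP j) v0.
  exists (enorm (p (leader j) - p (follower m)) * c); apply/eqP.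
  rewrite addrC -subr_eq -scalerA -gE -pg; apply/eqP/bearing_scale/pD.
(* Leaders 0 and 1 exist since [1 < m]; together with the follower they would be collinear. *)
apply: (ncol (Ordinal (ltnW m1)) (Ordinal m1)) => //.
exists (p (follower m)), v^T => w [->|->|->]; [exact: par|exact: par|].
by exists 0; rewrite scale0r addr0.
Qed.

Lemma oproj_leader (R : realType) (d m : nat) (g : 'I_m -> 'cV[R]_d)
    (p : configuration R d m) (j : 'I_m) :
  enorm (g j) = 1 -> bearing_fiber g p ->
  oproj (g j) *m p (leader j) = oproj (g j) *m p (follower m).
Proof.
move=> g1 [pD pg]; apply/subr0_eq; rewrite -mulmxBr bearing_scale; last exact: pD.
have -> : bearing (p (follower m)) (p (leader j)) = g j by rewrite -pg.
by rewrite -scalemxAr oproj_self// scaler0.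
Qed.

(** The mean value theorem is applied to each coordinate on $[0,t]$: it asks for the derivative only
    inside the interval and for continuity up to the ends, which is what [is_solution] provides at
    time 0. *)
Lemma is_solution0_cst (R : realType) (d : nat) (x : R -> 'cV[R]_d) :
  is_solution (fun _ _ => 0) x -> forall t, 0 <= t -> x t = x 0.
Proof.
move=> [xC xD] t t0; apply/matrixP => i j; apply/eqP; rewrite -subr_eq0.
have [s _ ->] : exists2 s, s \in `[0, t]%R & x t i j - x 0 i j = 0 * (t - 0).
  apply: (MVT_segment (f := fun s => x s i j) (df := fun=> 0) t0) => [s|].
    rewrite in_itv /= => /andP[s0 _]; have [dx vx] := xD s s0.
    apply: DeriveDef; first by move/derivable_mxP: dx.
    by move: (derive_mx dx); rewrite vx => /matrixP/(_ i j); rewrite !mxE.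
  apply: (@within_continuous_comp _ _ _ _ x (fun M : 'cV[R]_d => M i j)).
    by move=> M _; exact: coord_continuous.
  apply: continuous_subspaceW xC => s /=.
  by rewrite !in_itv /= andbT => /andP[].
by rewrite mul0r.
Qed.

Lemma with_follower_restrict (R : realType) (d m : nat)
    (p : configuration R d m) :
  with_follower (fun j => p (leader j)) (p (follower m)) = p.
Proof.
by apply/funext => k; rewrite /with_follower; case: unliftP => [j ->|->].
Qed.

Lemma fiber_follower_velocity (R : realType) (d m : nat)
    (g : 'I_m -> 'cV[R]_d) (p : configuration R d m) :
  (forall j, enorm (g j) = 1) -> bearing_fiber g p ->
  follower_velocity g p = 0.
Proof.
move=> g1 [_ pg]; rewrite /follower_velocity pg big1 ?oppr0// => j _.
exact: oproj_self.
Qed.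

Theorem proposition1 (R : realType) (d m : nat) (hn : (3 <= m.+1)%N)
    (g : 'I_m -> 'cV[R]_d) (hg : forall j : 'I_m, enorm (g j) = 1)
    (hA : assumption1 g)
    (p : configuration R d m) (hp : bearing_fiber g p)
    (l : R -> 'I_m -> 'cV[R]_d)
    (hl0 : forall i : 'I_m, l 0 i = p (leader i))
    (hl : forall i : 'I_m, is_solution (fun _ _ => 0) (fun t => l t i)) :
  [/\ \sum_(j < m) oproj (g j) \in unitmx,
      p (follower m) =
        invmx (\sum_(j < m) oproj (g j)) *m
          (\sum_(j < m) oproj (g j) *m p (leader j))
    & follower_equilibrium g l (p (follower m))].
Proof.
have U : \sum_(j < m) oproj (g j) \in unitmx by exact: sum_oproj_unitmx.
split => //.
  (* Once each leader position is replaced by that of the follower, the right-hand sum is the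
     invertible matrix times [p (follower m)]. *)
  rewrite (eq_bigr _ (fun j _ => oproj_leader _ _ _ _ _ j (hg j) hp)).
  by rewrite -mulmx_suml mulKmx.
(* With the leaders fixed, the configuration at every time is [p] itself, which lies in the fiber of
   [g]. *)
move=> t t0; have -> : l t = fun j => p (leader j).
  by apply/funext => j; rewrite (is_solution0_cst _ _ _ (hl j) _ t0).
rewrite /= with_follower_restrict fiber_follower_velocity//.
by split => //; case: hp.
Qed.
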